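(* Let $\Omega\subset\mathbb{R}$ be open and bounded, $\mathbb{T}=\mathbb{R}/2\pi\mathbb{Z}$, let $\omega=H_0':\Omega\to\mathbb{R}$ be the frequency map of an integrable Hamiltonian $H(I,\theta)=H_0(I)$ on $\Omega\times\mathbb{T}$, let $c>0$ be a constant, let $(B_t)_{t\ge0}$ be a standard Brownian motion, and for $j\in\mathbb{N}$ let $$\mathcal{S}_{H_0}^{j}(I,\theta)=(I,\theta+j\,\omega(I)+cB_j).$$ Assume $G\in C_b(\Omega\times\mathbb{T})$ and that the initial point $(I,\theta)$ is distributed with probability density $\rho_0\in L^2(\Omega\times\mathbb{T})$. Then $$\lim_{N\to\infty}\mathbb{E}\big(V_N(\langle G\rangle_{\mathcal{S}})\big)=\langle\bar G(I)\rangle_0,$$ where $\displaystyle\bar G(I)=\frac1{2\pi}\int_{\mathbb{T}}G(I,\theta)\,d\theta$.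
   Context: $V_N(\langle G\rangle_{\mathcal{S}})=\frac1N\sum_{j=1}^N\int_{\Omega\times\mathbb{T}}G(\mathcal{S}_{H_0}^{j}(I,\theta))\,\rho_0(I,\theta)\,dI\,d\theta$, a random variable depending on the Brownian path; $\mathbb{E}$ is the expectation over the Brownian motion. $\langle\bar G(I)\rangle_0=\int_{\Omega\times\mathbb{T}}\bar G(I)\,\rho_0(I,\theta)\,dI\,d\theta$. $C_b$ denotes bounded continuous (possibly complex-valued) functions. *)

(* Defs.v *)
From HB Require Import structures.
From mathcomp Require Import all_boot all_order all_algebra.
From mathcomp Require Import all_classical all_reals all_analysis.
From mathcomp Require Import measurable_realfun complex.

Set Implicit Arguments.
Unset Strict Implicit.
Unset Printing Implicit Defensive.

Import Order.TTheory GRing.Theory Num.Theory.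
Import numFieldNormedType.Exports.

Local Open Scope classical_set_scope.
Local Open Scope ring_scope.
Local Open Scope complex_scope.

Section Torus.
Variable R : realType.

(* Plain [pi] is captured by the canonical surjection of generic_quotient,
   hence the qualified [trigo.pi] for the real number. *)
Definition two_pi_int : {pred R} :=
  [pred x | `[< exists k : int, x = k%:~R * (2 * trigo.pi) >]].

Lemma two_pi_int_zmod_closed : zmod_closed two_pi_int.
Proof.
split=> [|x y]; first by apply/asboolP; exists 0; rewrite mul0r.
move=> /asboolP[k ->] /asboolP[l ->]; apply/asboolP.
by exists (k - l); rewrite intrB mulrBl.
Qed.

HB.instance Definition _ :=
  GRing.isZmodClosed.Build R two_pi_int two_pi_int_zmod_closed.

Definition torus : Type := Quotient.quot two_pi_int.

HB.instance Definition _ :=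
  Topological.copy torus (quotient_topology (Quotient.quot two_pi_int)).
HB.instance Definition _ := Quotient.on torus.
HB.instance Definition _ := GRing.Zmodule.on torus.
HB.instance Definition _ := isPointed.Build torus 0.
(* Borel sigma-algebra of the quotient topology. *)
HB.instance Definition _ := @isMeasurable.Build (sigma_display (@open torus))
  torus <<s @open torus >> (@sigma_algebra0 _ setT _) (@sigma_algebraC _ _)
  (@sigma_algebra_bigcup _ setT _).

Definition to_torus (x : R) : torus := (\pi_torus x)%qT.

Lemma continuous_to_torus : continuous to_torus.
Proof. exact: pi_continuous. Qed.

Lemma measurable_to_torus : measurable_fun setT to_torus.
Proof.
apply: (@measurability _ _ _ _ _ _ (@open torus)) => //.
move=> _ [U oU <-]; rewrite setTI; apply: open_measurable.
by move/continuousP: continuous_to_torus; apply.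
Qed.

(* d theta, of total mass 2 * pi: image of the Lebesgue measure of the
   fundamental domain [0, 2 pi[ under the projection. *)
Definition torus_measure (A : set torus) : \bar R :=
  lebesgue_measure (to_torus @^-1` A `&` `[0, 2 * trigo.pi[).

Let torus_measure0 : torus_measure set0 = 0%E.
Proof. by rewrite /torus_measure preimage_set0 set0I measure0. Qed.

Let torus_measure_ge0 A : (0 <= torus_measure A)%E.
Proof. exact: measure_ge0. Qed.

Let torus_measure_sigma_additive : semi_sigma_additive torus_measure.
Proof.
move=> F mF tF mUF; rewrite /torus_measure preimage_bigcup setI_bigcupl.
have mF' i : measurable (to_torus @^-1` F i `&` `[0, 2 * trigo.pi[).
  apply: measurableI => //; rewrite -[X in measurable X]setTI.
  exact: measurable_to_torus.
apply: measure_semi_sigma_additive => //; last by apply: bigcup_measurable => i _; exact: mF'.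
apply/trivIsetP => i j _ _ ij; rewrite setIACA setIid -preimage_setI.
by move/trivIsetP : tF => /(_ i j I I ij) ->; rewrite preimage_set0 set0I.
Qed.

HB.instance Definition _ := isMeasure.Build _ _ _ torus_measure
  torus_measure0 torus_measure_ge0 torus_measure_sigma_additive.

Let torus_measure_fin : fin_num_fun torus_measure.
Proof.
apply: lty_fin_num_fun; rewrite /= /torus_measure preimage_setT setTI.
by rewrite lebesgue_measure_itv/=; case: ifP; rewrite ?ltry.
Qed.

HB.instance Definition _ :=
  @Measure_isFinite.Build _ _ _ torus_measure torus_measure_fin.

End Torus.

Notation phase_space R := (measurableTypeR R * torus R)%type.

Definition phase_measure (R : realType) :
    {measure set (phase_space R) -> \bar R} :=
  (lebesgue_measure \x @torus_measure R)%E.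

(* [R[i]^o] rather than [R[i]] is what carries the norm topology. *)
Definition cintegral d (T : measurableType d) (R : realType)
    (mu : {measure set T -> \bar R}) (D : set T) (f : T -> R[i]) : R[i]^o :=
  (\int[mu]_(x in D) complex.Re (f x)) +i* (\int[mu]_(x in D) complex.Im (f x)).

Record standard_brownian d (W : measurableType d) (R : realType)
    (P : probability W R) (B : R -> W -> R) : Prop := StandardBrownian {
  brownian_measurable : forall t, 0 <= t -> measurable_fun setT (B t) ;
  brownian_start : {ae P, forall w, B 0 w = 0} ;
  (* the second parameter of [normal_prob] is the standard deviation *)
  brownian_normal : forall s t, 0 <= s -> s < t ->
    forall A : set (measurableTypeR R), measurable A ->
      pushforward P (fun w => B t w - B s w : measurableTypeR R) A =
      normal_prob 0 (Num.sqrt (t - s)) A ;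
  brownian_indep : forall (n : nat) (t : nat -> R)
      (A : nat -> set (measurableTypeR R)),
    0 <= t 0%N -> {homo t : i j / (i <= j)%N >-> i <= j} ->
    (forall i, measurable (A i)) ->
    P (\bigcap_(i in `I_n) [set w | A i (B (t i.+1) w - B (t i) w)]) =
    (\prod_(i < n) P [set w | A i (B (t i.+1) w - B (t i) w)%R])%E ;
  brownian_continuous :
    {ae P, forall w, {within `[0, +oo[, continuous (fun t => B t w)}} }.

Section Averages.
Variable R : realType.
Implicit Types (Omega : set R) (G : phase_space R -> R[i]^o)
  (rho : phase_space R -> R).

(* Functions on Omega x T are total functions on R x T of which only the values
   on [Omega `*` setT] matter. *)
Definition bounded_continuous Omega G : Prop :=
  {within Omega `*` setT, continuous G} /\
  exists M : R, forall x, (Omega `*` setT) x -> `|G x| <= M%:C.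

(* Nonnegativity is only almost everywhere: a density in L^2 is a class of
   functions modulo null sets. *)
Definition probability_density Omega rho : Prop :=
  {ae @phase_measure R, forall x, (Omega `*` setT) x -> 0 <= rho x} /\
  (\int[@phase_measure R]_(x in Omega `*` setT) (rho x)%:E = 1)%E.

Definition stochastic_map (omega : R -> R) (c : R) (b : nat -> R) (j : nat)
    (x : phase_space R) : phase_space R :=
  (x.1, x.2 + to_torus (j%:R * omega x.1 + c * b j)).

Definition phase_average Omega rho (F : phase_space R -> R[i]) : R[i]^o :=
  cintegral (@phase_measure R) (Omega `*` setT)
    (fun x => F x * (rho x)%:C).

Definition time_average Omega rho (S : nat -> phase_space R -> phase_space R)
    G (N : nat) : R[i]^o :=
  N%:R^-1 * \sum_(1 <= j < N.+1) phase_average Omega rho (G \o S j).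

Definition angle_average G (I : R) : R[i]^o :=
  (2 * trigo.pi)^-1%:C * cintegral (@torus_measure R) setT (fun th => G (I, th)).

End Averages.

(* Main.v *)
(* By Fubini it suffices to study, for each point (I, theta), the expectation of
   p(c B_j + a), where p is a 2 pi-periodic function and a a shift depending on j.
   Since p is periodic, averaging its Gaussian expectation over all shifts
   t in [0, 2 pi] yields exactly the mean of p, and shifting changes the
   expectation by at most the supremum of |p| times the L1 distance between the
   Gaussian density of variance j and its translate by t / c.  That distance is
   at most e / 2 + (exp (t^2 / (c^2 j)) - 1) / (2 e) for every e > 0, so the
   expectations tend to the mean uniformly in (I, theta); the limit can be
   integrated against rho_0, and Cesaro's theorem concludes. *)

Require Import Defs.
From HB Require Import structures.
From mathcomp Require Import all_boot all_order all_algebra.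
From mathcomp Require Import all_classical all_reals all_analysis.
From mathcomp Require Import measurable_realfun complex.
From mathcomp Require Import ring lra zify.

Set Implicit Arguments.
Unset Strict Implicit.
Unset Printing Implicit Defensive.

Import Order.TTheory GRing.Theory Num.Theory.
Import numFieldNormedType.Exports.

Local Open Scope classical_set_scope.
Local Open Scope ring_scope.
Local Open Scope complex_scope.

Section RealIntegrable.
Context d (T : measurableType d) (R : realType).
Variables (mu : {measure set T -> \bar R}) (D : set T).
Hypothesis mD : measurable D.
Implicit Types f g : T -> R.

Lemma integrable_addr f g :
  mu.-integrable D (EFin \o f) -> mu.-integrable D (EFin \o g) ->
  mu.-integrable D (EFin \o (fun x => f x + g x)).
Proof.
by move=> fi gi; apply: eq_integrable (integrableD mD fi gi) => // x _.
Qed.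

Lemma integrable_subr f g :
  mu.-integrable D (EFin \o f) -> mu.-integrable D (EFin \o g) ->
  mu.-integrable D (EFin \o (fun x => f x - g x)).
Proof.
by move=> fi gi; apply: eq_integrable (integrableB mD fi gi) => // x _.
Qed.

Lemma integrable_scaler r f : mu.-integrable D (EFin \o f) ->
  mu.-integrable D (EFin \o (fun x => r * f x)).
Proof.
by move=> fi; apply: eq_integrable (integrableZl mD r fi) => // x _.
Qed.

Lemma integrable_normr f : mu.-integrable D (EFin \o f) ->
  mu.-integrable D (EFin \o (fun x => `|f x|)).
Proof.
by move=> fi; apply: eq_integrable (integrable_abse fi) => // x _.
Qed.

Lemma measurable_integrable f : mu.-integrable D (EFin \o f) -> measurable_fun D f.
Proof. by move=> /measurable_int /measurable_EFinP. Qed.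

Lemma integrable_bounded_mulr f g M : measurable_fun D g ->
  (forall x, D x -> `|g x| <= M) -> mu.-integrable D (EFin \o f) ->
  mu.-integrable D (EFin \o (fun x => g x * f x)).
Proof.
move=> mg gM fi; apply: (@le_integrable _ _ _ mu _ mD _
  (EFin \o (fun x => M * f x))); last exact: integrable_scaler.
  by apply/measurable_EFinP; apply: measurable_funM => //; exact: measurable_integrable.
move=> x Dx /=; rewrite lee_fin !normrM ler_wpM2r//.
by rewrite (le_trans (gM _ Dx))// ler_norm.
Qed.

Lemma integrable_bounded f M : (mu D < +oo)%E -> measurable_fun D f ->
  (forall x, D x -> `|f x| <= M) -> mu.-integrable D (EFin \o f).
Proof.
move=> muD mf fM; apply: measurable_bounded_integrable => //.
exists `|M|; split=> // r Mr x Dx /=.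
by rewrite (le_trans (fM _ Dx))// (le_trans (ler_norm _))// ltW.
Qed.

End RealIntegrable.

Section MeasurableParameterIntegral.
Context d1 d2 (X : measurableType d1) (Y : measurableType d2) (R : realType).
Variables (m2 : {sigma_finite_measure set Y -> \bar R}) (f2 : Y -> R) (g : X * Y -> R) (M : R).
Hypotheses (if2 : m2.-integrable setT (EFin \o f2))
  (mg : measurable_fun setT g) (gM : forall z, `|g z| <= M).

Lemma integrable_section x : m2.-integrable setT (EFin \o (fun y => g (x, y) * f2 y)).
Proof.
apply: (@integrable_bounded_mulr _ _ _ m2 _ measurableT _ _ M) => //.
exact: measurableT_comp.
Qed.

Lemma normr_Rintegral_section x :
  `|\int[m2]_y (g (x, y) * f2 y)| <= M * \int[m2]_y `|f2 y|.
Proof.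
have i2 := integrable_section x; have i2' := integrable_normr measurableT if2.
apply: (le_trans (le_normr_Rintegral _ i2)) => //.
rewrite -RintegralZl//; apply: le_Rintegral => //; first exact: integrable_normr.
  exact: integrable_scaler.
by move=> y _; rewrite normrM ler_wpM2r.
Qed.

Lemma measurable_Rintegral_section :
  measurable_fun setT (fun x => \int[m2]_y (g (x, y) * f2 y)).
Proof.
pose K (z : X * Y) := (g z * f2 z.2)%:E.
have mK : measurable_fun setT K.
  apply/measurable_EFinP; apply: measurable_funM => //.
  by apply: measurableT_comp => //; exact: measurable_integrable if2.
rewrite (_ : (fun x => _) = fine \o (fun x => (\int[m2]_y K^\+ (x, y) - \int[m2]_y K^\- (x, y))%E)).
  apply: measurableT_comp => //; apply: emeasurable_funB.
    apply: (@measurable_fun_fubini_tonelli_F _ _ _ _ _ m2 K^\+)%E => //.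
    exact: measurable_funepos.
  apply: (@measurable_fun_fubini_tonelli_F _ _ _ _ _ m2 K^\-)%E => //.
  exact: measurable_funeneg.
apply/funext => x; rewrite /Rintegral/=; congr fine.
by rewrite [LHS]integralE; congr (_ - _)%E; apply: eq_integral => y _; rewrite ?funeposE ?funenegE.
Qed.

End MeasurableParameterIntegral.

Section FubiniBounded.
Context d1 d2 (X : measurableType d1) (Y : measurableType d2) (R : realType).
Variables (m1 : {sigma_finite_measure set X -> \bar R})
  (m2 : {sigma_finite_measure set Y -> \bar R}).
Variables (f1 : X -> R) (f2 : Y -> R) (g : X * Y -> R) (M : R).
Hypotheses (if1 : m1.-integrable setT (EFin \o f1))
  (if2 : m2.-integrable setT (EFin \o f2))
  (mg : measurable_fun setT g) (gM : forall z, `|g z| <= M).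

Lemma integrable_tensor :
  (m1 \x m2)%E.-integrable setT (EFin \o (fun z => f1 z.1 * f2 z.2)).
Proof.
apply/integrable12ltyP.
  apply/measurable_EFinP; apply: measurable_funM; apply: measurableT_comp => //.
    exact: measurable_integrable if1.
  exact: measurable_integrable if2.
have i1 := integrable_normr measurableT if1.
have i2 := integrable_normr measurableT if2.
pose C := \int[m2]_y `|f2 y|.
rewrite (_ : (\int[m1]_x _)%E = (\int[m1]_x (C * `|f1 x|)%:E)%E).
  by apply: integrable_lty => //; exact: integrable_scaler.
apply: eq_integral => x _; rewrite [in RHS]mulrC EFinM /C /Rintegral fineK ?integrable_fin_num//.
rewrite -integralZl//; apply: eq_integral => y _ /=.
by rewrite normrM EFinM.
Qed.

Let gswap (z : Y * X) := g (z.2, z.1).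

Let mgswap : measurable_fun setT gswap.
Proof. by apply: measurableT_comp => //; exact: measurable_fun_pair. Qed.

Let EFin_inner2 x :
  (\int[m2]_y (g (x, y) * (f1 x * f2 y))%:E)%E = (f1 x * \int[m2]_y (g (x, y) * f2 y))%:E.
Proof.
have i2 := integrable_section if2 mg gM x.
rewrite EFinM /Rintegral fineK ?integrable_fin_num// -integralZl//.
by apply: eq_integral => y _; rewrite -EFinM mulrCA.
Qed.

Let EFin_inner1 y :
  (\int[m1]_x (g (x, y) * (f1 x * f2 y))%:E)%E = (\int[m1]_x (g (x, y) * f1 x) * f2 y)%:E.
Proof.
have i1 := integrable_section if1 mgswap (fun z => gM (z.2, z.1)) y.
rewrite EFinM /Rintegral fineK ?integrable_fin_num// -integralZr//.
by apply: eq_integral => x _; rewrite -EFinM mulrA.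
Qed.

Lemma Rintegral_Fubini :
  \int[m1]_x (f1 x * \int[m2]_y (g (x, y) * f2 y)) =
  \int[m2]_y (\int[m1]_x (g (x, y) * f1 x) * f2 y).
Proof.
have := Fubini (integrable_bounded_mulr measurableT mg (fun z _ => gM z) integrable_tensor).
under eq_integral do rewrite /= EFin_inner2.
under [X in _ = X]eq_integral do rewrite /= EFin_inner1.
by move=> H; rewrite /Rintegral H.
Qed.

End FubiniBounded.

Section Translation.
Variable R : realType.
Local Notation mu := (@lebesgue_measure R).

Lemma lebesgue_measure_translation (t : R) (A : set R) : measurable A ->
  pushforward mu ((fun x => x + t) : _ -> measurableTypeR R) A = mu A.
Proof.
move=> mA; apply/esym/lebesgue_measure_unique => //=.
  exact: measurable_funD.
move=> _ _ [[a b] _ <-]; rewrite /pushforward.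
have -> : (fun x : R => x + t) @^-1` [set` `]a, b]] = [set` `]a - t, b - t]].
  by apply/seteqP; split => x /=; rewrite !in_itv/= ltrBlDr lerBrDr.
rewrite !lebesgue_measure_itv/= !lte_fin ltrD2r.
by congr (if _ then _ else _); rewrite -!EFinB; congr EFin; ring.
Qed.

Lemma integral_translation (t : R) (f : R -> \bar R) (D : set R) :
  measurable D -> measurable_fun setT f ->
  mu.-integrable ((fun x => x + t) @^-1` D) (fun x => f (x + t)) ->
  (\int[mu]_(x in ((fun x => x + t) @^-1` D)%R) f (x + t)%R = \int[mu]_(x in D) f x)%E.
Proof.
move=> mD mf fi.
have mt : measurable_fun setT ((fun x => x + t) : measurableTypeR R -> measurableTypeR R).
  exact: measurable_funD.
rewrite -(@integral_pushforward _ _ (measurableTypeR R) (measurableTypeR R) _ _ mt mu D f)//.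
apply: eq_measure_integral => //= A mA _.
exact: lebesgue_measure_translation.
Qed.

End Translation.

Section GaussianShift.
Variable R : realType.
Local Notation mu := (@lebesgue_measure R).

Lemma normal_pdf_expR (m s x : R) : s != 0 ->
  normal_pdf m s x = normal_peak s * expR (- (x - m) ^+ 2 / (s ^+ 2 *+ 2)).
Proof. by move=> s0; rewrite normal_pdfE. Qed.

Lemma normal_pdf_shift (m s t x : R) : s != 0 ->
  normal_pdf m s (x + t) = normal_pdf (m - t) s x.
Proof.
by move=> s0; rewrite !normal_pdf_expR// opprB addrA (addrAC x).
Qed.

(* With L the likelihood ratio of the two densities: AM-GM gives
   [|L - 1| <= e / 2 + (L - 1)^2 / (2 e)], and L^2 times the centred density is again,
   up to a constant, a normal density, of mean [2 m]. *)
Lemma normal_pdf_chi2 (m s x e : R) : s != 0 -> 0 < e ->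
  `|normal_pdf m s x - normal_pdf 0 s x| <=
  e / 2 * normal_pdf 0 s x + (2 * e)^-1 * (normal_pdf 0 s x - 2 * normal_pdf m s x
     + expR (m ^+ 2 / s ^+ 2) * normal_pdf (2 * m) s x).
Proof.
move=> s0 e0.
pose L := expR ((2 * m * x - m ^+ 2) / (s ^+ 2 *+ 2)).
have Lm : normal_pdf m s x = L * normal_pdf 0 s x.
  rewrite !normal_pdf_expR// mulrCA; congr (_ * _); rewrite -expRD; congr expR.
  rewrite -mulr_natl; field.
  by rewrite s0.
have Lm2 : expR (m ^+ 2 / s ^+ 2) * normal_pdf (2 * m) s x = L ^+ 2 * normal_pdf 0 s x.
  rewrite !normal_pdf_expR// !(mulrCA _ (normal_peak s)); congr (_ * _).
  rewrite /L -expRM_natl -!expRD; congr expR.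
  rewrite -(mulr_natl (s ^+ 2)); field.
  by rewrite s0.
rewrite Lm2 Lm.
have := normal_pdf_ge0 0 s x; set p := normal_pdf 0 s x => p0.
rewrite -{2}(mul1r p) -mulrBl normrM (ger0_norm p0).
rewrite (_ : _ + _ = (e / 2 + (2 * e)^-1 * (L - 1) ^+ 2) * p); last by ring.
apply: ler_wpM2r => //.
rewrite -real_normK ?num_real//.
set a := `|L - 1|.
rewrite -subr_ge0 (_ : _ - _ = (2 * e)^-1 * (e - a) ^+ 2).
  by rewrite mulr_ge0 ?sqr_ge0// invr_ge0 mulr_ge0// ltW.
by field; rewrite gt_eqF.
Qed.

Lemma normal_pdf_L1 (m s e : R) : s != 0 -> 0 < e ->
  \int[mu]_x `|normal_pdf m s x - normal_pdf 0 s x| <=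
    e / 2 + (2 * e)^-1 * (expR (m ^+ 2 / s ^+ 2) - 1).
Proof.
move=> s0 e0.
have ip n : mu.-integrable setT (EFin \o normal_pdf n s).
  exact: integrable_normal_pdf.
have Ip n : \int[mu]_x normal_pdf n s x = 1.
  by rewrite /Rintegral integral_normal_pdf.
have iZ r f := @integrable_scaler _ _ _ mu _ measurableT r f.
have iD f g := @integrable_addr _ _ _ mu _ measurableT f g.
have iB f g := @integrable_subr _ _ _ mu _ measurableT f g.
have i1 := iZ (e / 2) _ (ip 0).
have i2 := iD _ _ (iB _ _ (ip 0) (iZ 2 _ (ip m)))
   (iZ (expR (m ^+ 2 / s ^+ 2)) _ (ip (2 * m))).
apply: (@le_trans _ _ (\int[mu]_x (e / 2 * normal_pdf 0 s x +
    (2 * e)^-1 * (normal_pdf 0 s x - 2 * normal_pdf m s x +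
      expR (m ^+ 2 / s ^+ 2) * normal_pdf (2 * m) s x)))).
  apply: le_Rintegral => //.
  - exact: integrable_normr (iB _ _ (ip m) (ip 0)).
  - by apply: iD => //; exact: iZ.
  - by move=> x _; exact: normal_pdf_chi2.
rewrite RintegralD//; last exact: iZ.
rewrite !RintegralZl// RintegralD//; last 2 first.
- by apply: iB => //; exact: iZ.
- exact: iZ.
rewrite RintegralB//; last exact: iZ.
by rewrite !RintegralZl// !Ip; lra.
Qed.

End GaussianShift.

Section PeriodicMean.
Variable R : realType.
Local Notation mu := (@lebesgue_measure R).

Lemma Rintegral_translation (t : R) (f : R -> R) (D : set R) :
  measurable D -> measurable_fun setT f ->
  mu.-integrable ((fun x => x + t) @^-1` D) (EFin \o (fun x => f (x + t))) ->
  \int[mu]_(x in (fun x => x + t) @^-1` D) f (x + t) = \int[mu]_(x in D) f x.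
Proof.
move=> mD mf fi; rewrite /Rintegral; congr fine.
by apply: (@integral_translation R t (EFin \o f)) => //; exact/measurable_EFinP.
Qed.

Lemma measurable_shift (f : R -> R) (b : R) : measurable_fun setT f ->
  measurable_fun setT (fun x : R => f (x + b)).
Proof. by move=> mf; apply: measurableT_comp => //; exact: measurable_funD. Qed.

Lemma lebesgue_measure_itv_lty (a b : R) (x y : bool) :
  (mu [set` Interval (BSide x a) (BSide y b)] < +oo)%E.
Proof. by rewrite lebesgue_measure_itv/=; case: ifP; rewrite ?ltry. Qed.

Variables (p : R -> R) (T M : R).
Hypotheses (T0 : 0 < T) (mp : measurable_fun setT p)
  (pM : forall x, `|p x| <= M) (pT : periodic p T).

Lemma periodicz (k : int) (x : R) : p (x + k%:~R * T) = p x.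
Proof.
case: k => n; first by rewrite -pmulrn mulr_natl (periodicn pT).
by rewrite -[LHS](periodicn pT n.+1) NegzE mulrNz mulNr -pmulrn mulr_natl addrNK.
Qed.

Let ip (D : set R) : measurable D -> (mu D < +oo)%E -> mu.-integrable D (EFin \o p).
Proof.
by move=> mD Doo; apply: (@integrable_bounded _ _ _ mu D mD p M) => //; exact: measurable_funTS.
Qed.

Let ips (b : R) (D : set R) : measurable D -> (mu D < +oo)%E -> 
  mu.-integrable D (EFin \o (fun x => p (x + b))).
Proof.
move=> mD Doo; apply: (@integrable_bounded _ _ _ mu D mD _ M) => //; apply: measurable_funTS.
exact: measurable_shift.
Qed.

Lemma Rintegral_periodic_shift (b : R) :
  \int[mu]_(t in `[0, T[) p (t + b) = \int[mu]_(t in `[0, T[) p t.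
Proof.
wlog /andP[b0 bT] : b / 0 <= b < T.
  move=> H; pose k := Num.floor (b / T).
  have /andP[k1 k2] := floor_itv (b / T).
  rewrite -(H (b - k%:~R * T)); last first.
    rewrite ler_pdivlMr// in k1; rewrite ltr_pdivrMr// intrD mulrDl mul1r in k2.
    by rewrite subr_ge0 k1/= ltrBlDl.
  by apply: eq_Rintegral => t _; rewrite -(periodicz k (t + (b - _))) -addrA subrK.
have pre (r x y : R) : (fun z => z + r) @^-1` [set` `[x, y[] = [set` `[x - r, y - r[].
  by apply/seteqP; split => t /=; rewrite !in_itv/= ?lerBlDr ?ltrBrDr.
have -> : [set` `[0, T[] = [set` `[0, T - b[] `|` [set` `[T - b, T[] :> set R.
  by rewrite -itv_bndbnd_setU// bnd_simp; lra.
rewrite [LHS]Rintegral_setU//; last 2 first.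
- rewrite -itv_bndbnd_setU ?bnd_simp//; [|lra..].
  by apply: ips => //; exact: lebesgue_measure_itv_lty.
- by apply/disj_set2P/seteqP; split=> x //=; rewrite !in_itv/=; lra.
have -> : [set` `[0, T - b[] `|` [set` `[T - b, T[] = [set` `[0, b[] `|` [set` `[b, T[] :> set R.
  by rewrite -!itv_bndbnd_setU// ?bnd_simp; lra.
rewrite [RHS]Rintegral_setU//; last 2 first.
- rewrite -itv_bndbnd_setU ?bnd_simp//; [|lra..].
  by apply: ip => //; exact: lebesgue_measure_itv_lty.
- by apply/disj_set2P/seteqP; split=> x //=; rewrite !in_itv/=; lra.
rewrite addrC; congr (_ + _).
  transitivity (\int[mu]_(t in `[T - b, T[) p (t + (b - T))).
    by apply: eq_Rintegral => t _; rewrite -[RHS]pT; congr p; ring.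
  have pre0 : (fun x => x + (b - T)) @^-1` [set` `[0, b[] = [set` `[T - b, T[].
    by rewrite pre sub0r opprB addrCA subrr addr0.
  rewrite -(@Rintegral_translation (b - T) p `[0, b[)// pre0//.
  by apply: ips => //; exact: lebesgue_measure_itv_lty.
rewrite -(@Rintegral_translation b p `[b, T[)// pre ?subrr//.
by apply: ips => //; exact: lebesgue_measure_itv_lty.
Qed.

End PeriodicMean.

Section IndicatorIntegral.
Variable R : realType.
Local Notation mu := (@lebesgue_measure R).

Lemma integrable_indic_itv (a b : R) :
  mu.-integrable setT (EFin \o (\1_(`[a, b[) : R -> R)).
Proof.
have mJ : measurable (`[a, b[%classic : set (measurableTypeR R)) by exact: measurable_itv.
have : mu.-integrable `[a, b[ (cst 1%:E).
  apply: (@integrable_bounded _ _ _ mu _ mJ (cst 1) 1) => //= *; last by rewrite normr1.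
  exact: lebesgue_measure_itv_lty.
move/integrable_mkcond => /(_ mJ); apply: eq_integrable => // x _ /=.
by rewrite patchE indicE; case: ifP.
Qed.

Lemma Rintegral_indicr (D : set R) (f : R -> R) :
  \int[mu]_(x in D) f x = \int[mu]_x (f x * \1_D x).
Proof.
rewrite Rintegral_mkcond; apply: eq_Rintegral => x _.
by rewrite patchE indicE; case: ifP => _; rewrite ?mulr1 ?mulr0.
Qed.

End IndicatorIntegral.

Section GaussianEquidistribution.
Variable R : realType.
Local Notation mu := (@lebesgue_measure R).

(* Averaging over the shifts t in [0, T] turns the Gaussian expectation of p into its
   mean, at the cost of the L1 distance between the density and its shifts. *)
Lemma gaussian_periodic_mean (p : R -> R) (T M c s e a : R) :
  0 < T -> measurable_fun setT p -> (forall x, `|p x| <= M) -> periodic p T ->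
  0 < c -> s != 0 -> 0 < e ->
  `|\int[mu]_x (p (c * x + a) * normal_pdf 0 s x) - T^-1 * \int[mu]_(t in `[0, T[) p t| <=
  M * (e / 2 + (2 * e)^-1 * (expR ((T / c) ^+ 2 / s ^+ 2) - 1)).
Proof.
move=> T0 mp pM pT c0 s0 e0.
set delta := _ / 2 + _.
have M0 : 0 <= M by rewrite (le_trans _ (pM 0)).
have mpc b : measurable_fun setT (fun x : R => p (c * x + b)).
  by apply: measurableT_comp => //; apply: measurable_funD => //; exact: measurable_funM.
have ip m : mu.-integrable setT (EFin \o normal_pdf m s).
  exact: integrable_normal_pdf.
have ipc m b : mu.-integrable setT (EFin \o (fun x => p (c * x + b) * normal_pdf m s x)).
  by apply: (@integrable_bounded_mulr _ _ _ mu _ measurableT _ _ M) => //; exact: mpc.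
set E := \int[mu]_x _.
pose F t := \int[mu]_x (p (c * x + (t + a)) * normal_pdf 0 s x).
have EF t : 0 <= t <= T -> `|E - F t| <= M * delta.
  move=> /andP[t0 tT].
  have -> : E = \int[mu]_x (p (c * x + (t + a)) * normal_pdf (- (t / c)) s x).
    pose f x := p (c * x + a) * normal_pdf 0 s x.
    have fE x : f (x + t / c) = p (c * x + (t + a)) * normal_pdf (- (t / c)) s x.
      by rewrite /f normal_pdf_shift// sub0r; congr (p _ * _); field; rewrite gt_eqF.
    transitivity (\int[mu]_(x in (fun x => x + t / c) @^-1` setT) f (x + t / c)).
      apply/esym/Rintegral_translation => //.
        by apply: measurable_funM => //; exact: measurable_normal_pdf.
      rewrite preimage_setT; apply: eq_integrable (ipc (- (t / c)) (t + a)) => //.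
      by move=> x _ /=; rewrite fE.
    by rewrite preimage_setT; apply: eq_Rintegral => x _; exact: fE.
  rewrite /F -RintegralB//.
  under eq_Rintegral do rewrite -mulrBr.
  have iB := integrable_subr measurableT (ip (- (t / c))) (ip 0).
  have iBp : mu.-integrable setT (EFin \o (fun x =>
      p (c * x + (t + a)) * (normal_pdf (- (t / c)) s x - normal_pdf 0 s x))).
    by apply: (@integrable_bounded_mulr _ _ _ mu _ measurableT _ _ M) => //; exact: mpc.
  apply: (le_trans (le_normr_Rintegral _ iBp)) => //.
  apply: (@le_trans _ _ (\int[mu]_x (M * `|normal_pdf (- (t / c)) s x - normal_pdf 0 s x|))).
    apply: le_Rintegral => //; first exact: integrable_normr.
      by apply: integrable_scaler => //; exact: integrable_normr.
    by move=> x _; rewrite normrM ler_wpM2r.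
  rewrite RintegralZl//; last exact: integrable_normr.
  rewrite ler_wpM2l// (le_trans (normal_pdf_L1 _ s0 e0))// lerD2l ler_wpM2l//.
    by rewrite invr_ge0 mulr_ge0// ltW.
  rewrite lerD2r ler_expR ler_wpM2r ?invr_ge0 ?sqr_ge0// sqrrN.
  by rewrite ler_sqr ?nnegrE ?divr_ge0 ?(ltW c0) ?(ltW T0)// ler_pM2r// invr_gt0.
pose J := [set` `[0, T[] : set R.
have mJ : measurable J by exact: measurable_itv.
have Joo : (mu J < +oo)%E by exact: lebesgue_measure_itv_lty.
have muJ : fine (mu J) = T.
  by rewrite /J lebesgue_measure_itv/= lte_fin T0 -EFinB/= subr0.
pose g (z : measurableTypeR R * measurableTypeR R) := p (c * z.2 + (z.1 + a)).
have mg : measurable_fun setT g.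
  apply: measurableT_comp => //; apply: measurable_funD; first exact: measurable_funM.
  exact: measurable_funD.
have iJ : mu.-integrable setT (EFin \o (\1_J : R -> R)).
  exact: integrable_indic_itv.
have FubF : \int[mu]_(t in J) F t = \int[mu]_(t in J) p t.
  rewrite [LHS]Rintegral_indicr; under eq_Rintegral do rewrite mulrC.
  rewrite (Rintegral_Fubini iJ (ip 0) mg (fun z => pM _)).
  transitivity (\int[mu]_x (\int[mu]_(t in J) p t * normal_pdf 0 s x)).
    apply: eq_Rintegral => x _; congr (_ * _).
    rewrite -(Rintegral_periodic_shift T0 mp pM pT (c * x + a)).
    rewrite [RHS]Rintegral_indicr.
    by apply: eq_Rintegral => t _; rewrite /g/= addrCA.
  by rewrite RintegralZl// /Rintegral integral_normal_pdf mulr1.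
have mF : measurable_fun setT F.
  exact: measurable_Rintegral_section (ip 0) mg.
have iF : mu.-integrable J (EFin \o F).
  apply: (@integrable_bounded _ _ _ mu _ _ _ (M * \int[mu]_x `|normal_pdf 0 s x|)) => //.
    exact: measurable_funTS.
  by move=> t _; exact: (normr_Rintegral_section (ip 0) mg (fun z => pM _) t).
have iE r : mu.-integrable J (EFin \o cst r).
  by apply: (@integrable_bounded _ _ _ mu _ _ _ `|r|) => //.
rewrite -FubF -(ler_pM2l T0) -{1}(gtr0_norm T0) -normrM mulrBr mulVKf ?gt_eqF//.
have -> : T * E = \int[mu]_(t in J) E by rewrite Rintegral_cst// muJ mulrC.
rewrite -RintegralB//; last exact: iE.
have iEF := @integrable_subr _ _ _ mu J mJ _ _ (iE E) iF.
apply: (le_trans (le_normr_Rintegral _ iEF)) => //.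
rewrite mulrC -muJ -(@Rintegral_cst _ _ _ mu J)//.
apply: le_Rintegral => //; [exact: integrable_normr|exact: iE|].
by move=> t; rewrite /J/= in_itv/= => /andP[t0 /ltW tT]; rewrite EF// t0.
Qed.

End GaussianEquidistribution.

Section NormalLaw.
Variable R : realType.
Local Notation mu := (@lebesgue_measure R).

Lemma integral_normal_prob (m s : R) (f : measurableTypeR R -> \bar R) :
  (normal_prob m s).-integrable setT f ->
  (\int[normal_prob m s]_x f x = \int[mu]_x (f x * (normal_pdf m s x)%:E))%E.
Proof.
move=> fi; have dom := normal_prob_dominates m s.
have mf := measurable_int _ fi.
rewrite -(Radon_Nikodym_change_of_variables dom)//=.
apply: ae_eq_integral => //.
- apply: emeasurable_funM => //; apply: (measurable_int mu).
- apply: emeasurable_funM => //=; apply/measurableT_comp => //=.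
  exact: measurable_normal_pdf.
- apply: ae_eqe_mul2l => /=.
  rewrite Radon_NikodymE//=; case: cid => /= h [h1 h2 h3].
  apply: integral_ae_eq => //=.
  + by apply/measurableT_comp =>//; exact: measurable_normal_pdf.
  + by move=> E _ mE; rewrite -h3.
Qed.

Lemma Rintegral_normal_law d (W : measurableType d) (P : probability W R)
    (X : W -> measurableTypeR R) (s : R) (f : R -> R) (M : R) :
  measurable_fun setT X ->
  (forall A : set (measurableTypeR R), measurable A ->
    pushforward P X A = normal_prob 0 s A) ->
  measurable_fun setT f -> (forall x, `|f x| <= M) ->
  \int[P]_w f (X w) = \int[mu]_x (f x * normal_pdf 0 s x).
Proof.
move=> mX lawX mf fM.
have iP : P.-integrable setT (EFin \o (f \o X)).
  apply: (@integrable_bounded _ _ _ P _ measurableT _ M) => //.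
    exact: (le_lt_trans (probability_le1 P measurableT) (ltry _)).
    exact: measurableT_comp.
  by move=> w _; exact: fM.
rewrite /Rintegral; congr fine.
transitivity (\int[normal_prob 0 s]_x (f x)%:E)%E.
  transitivity (\int[pushforward P X]_x (f x)%:E)%E.
    apply/esym/(@integral_pushforward _ _ _ _ _ X mX P setT (EFin \o f)) => //.
    exact/measurable_EFinP.
  by apply: eq_measure_integral => A mA _; exact: lawX.
rewrite integral_normal_prob//.
apply: (@integrable_bounded _ _ _ (normal_prob 0 s) _ measurableT _ M) => //.
exact: (le_lt_trans (probability_le1 _ measurableT) (ltry _)).
Qed.

Lemma Rintegral_brownian d (W : measurableType d) (P : probability W R) (B : R -> W -> R)
    (t : R) (f : R -> R) (M : R) :
  standard_brownian P B -> 0 < t -> measurable_fun setT f -> (forall x, `|f x| <= M) ->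
  \int[P]_w f (B t w) = \int[mu]_x (f x * normal_pdf 0 (Num.sqrt t) x).
Proof.
move=> HB t0 mf fM.
have mB r := brownian_measurable HB r.
have mBt : measurable_fun setT (fun w => B t w - B 0 w : measurableTypeR R).
  by apply: measurable_funB; [exact/mB/ltW|exact: mB].
rewrite -(@Rintegral_normal_law _ W P (fun w => B t w - B 0 w) _ _ M)//; last first.
  by move=> A mA; have := brownian_normal HB (lexx 0) t0 mA; rewrite subr0.
rewrite /Rintegral; congr fine; apply: ae_eq_integral => //.
- by apply/measurable_EFinP; apply: measurableT_comp => //; exact/mB/ltW.
- by apply/measurable_EFinP; apply: measurableT_comp => //.
by apply: filterS (brownian_start HB) => w /= -> _; rewrite subr0.
Qed.

End NormalLaw.

Section BorelPlane.
Variable R : realType.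

Lemma open_measurable_prod (U : set (R * R)) : open U ->
  @measurable _ (measurableTypeR R * measurableTypeR R)%type U.
Proof.
move=> oU.
pose box (q : rat * rat * (rat * rat)) : set (R * R) :=
  [set` `]ratr q.1.1, ratr q.1.2[] `*` [set` `]ratr q.2.1, ratr q.2.2[].
have -> : U = \bigcup_q (if `[< box q `<=` U >] then box q else set0).
  apply/seteqP; split => [[x y] Uxy|z [q _]]; last by case: asboolP => // qU /qU.
  have : nbhs (x, y) U by apply: open_nbhs_nbhs.
  move=> /nbhs_ballP[e /= e0 eU].
  have rat_itv (u : R) : exists q : rat * rat, [/\ u - e < ratr q.1, ratr q.1 < u,
      u < ratr q.2 & ratr q.2 < u + e].
    have [|q1] := @rat_in_itvoo _ (u - e) u; first by rewrite ltrBlDr ltrDl.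
    rewrite in_itv/= => /andP[? ?].
    have [|q2] := @rat_in_itvoo _ u (u + e); first by rewrite ltrDl.
    rewrite in_itv/= => /andP[? ?].
    by exists (q1, q2).
  have [p [p1 p2 p3 p4]] := rat_itv x; have [q [q1 q2 q3 q4]] := rat_itv y.
  exists (p, q) => //; case: asboolP => [_|]; first by rewrite /box /= !in_itv/= p2 p3 q2 q3.
  case=> -[u v] [/=]; rewrite !in_itv/= => /andP[u1 u2] /andP[v1 v2].
  by apply: eU; split => /=; rewrite /ball/= ltr_distl; lra.
apply: countable_bigcupT_measurable => [|q]; first exact: countableP.
by case: asboolP => // _; apply: measurableX; exact: measurable_itv.
Qed.

Lemma open_continuous_measurable_prod (D : set (R * R)) (f : R * R -> R) :
  open D -> {in D, continuous f} ->
  @measurable_fun _ _ (measurableTypeR R * measurableTypeR R)%type (measurableTypeR R) D f.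
Proof.
move=> oD cf; apply: (measurability _ (RGenOpens.measurableE R)).
move=> _ [_ [a [b ->] <-]]; apply: open_measurable_prod.
rewrite openE => z [Dz abz]; apply: filterI.
  by apply: open_nbhs_nbhs; split.
apply: (cf z); first exact/mem_set.
by apply: open_nbhs_nbhs; split=> //; exact: interval_open.
Qed.

End BorelPlane.

Section TorusAngle.
Variable R : realType.
Local Notation T := (2 * trigo.pi : R).

Lemma two_pi_gt0 : 0 < T.
Proof. by rewrite mulr_gt0// pi_gt0. Qed.

Lemma to_torusD (x y : R) : to_torus (x + y) = to_torus x + to_torus y.
Proof. exact: Quotient.pi_add. Qed.

Lemma to_torus_eqP (x y : R) :
  to_torus x = to_torus y <-> exists k : int, x = y + k%:~R * T.
Proof.
have <- : (x - y \in @two_pi_int R) <-> to_torus x = to_torus y.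
  by rewrite Quotient.idealrBE; split=> [/eqP xy|xy]; [exact: xy|apply/eqP; exact: xy].
split=> [/asboolP[k xy]|[k xy]]; first by exists k; rewrite -xy addrC subrK.
by apply/asboolP; exists k; rewrite xy addrC addKr.
Qed.

Lemma to_torus_periodic : periodic (@to_torus R) T.
Proof. by move=> x; apply/to_torus_eqP; exists 1; rewrite mul1r. Qed.

Definition angle (th : torus R) : R :=
  let y := repr th in y - (Num.floor (y / T))%:~R * T.

Lemma angleK : cancel angle (@to_torus R).
Proof.
move=> th; rewrite -[RHS]reprK; apply/to_torus_eqP.
by exists (- Num.floor (repr th / T)); rewrite mulrNz mulNr.
Qed.

Lemma angle_itv (th : torus R) : 0 <= angle th < T.
Proof.
rewrite /angle; set y := repr th.
have /andP[k1 k2] := floor_itv (y / T); have T0 := two_pi_gt0.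
rewrite ler_pdivlMr// in k1; rewrite ltr_pdivrMr// intrD mulrDl mul1r in k2.
by rewrite subr_ge0 k1/= ltrBlDl.
Qed.

Lemma to_torus_inj (x y : R) : 0 <= x < T -> 0 <= y < T ->
  to_torus x = to_torus y -> x = y.
Proof.
move=> /andP[x0 xT] /andP[y0 yT] /to_torus_eqP[k xy].
have T0 := two_pi_gt0.
have k1 : k < 1 by rewrite -(ltr_int R) -(ltr_pM2r T0) mulr1z; lra.
have k2 : -1 < k by rewrite -(ltr_int R) -(ltr_pM2r T0) mulrNz mulr1z; lra.
have k0 : k = 0 by lia.
by rewrite xy k0 mul0r addr0.
Qed.

Lemma angle_to_torus (x : R) : 0 <= x < T -> angle (to_torus x) = x.
Proof.
by move=> xT; apply: to_torus_inj => //; [exact: angle_itv|rewrite angleK].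
Qed.

Lemma measurable_angle : measurable_fun setT (angle : torus R -> measurableTypeR R).
Proof.
apply: (measurability _ (RGenOInfty.measurableE R)) => _ [_ [a ->] <-].
have [a0|a0] := ltP a 0.
  rewrite (_ : angle @^-1` _ = setT) ?setTI//.
  apply/seteqP; split => // th _ /=; rewrite in_itv/= andbT.
  by have /andP[+ _] := angle_itv th; exact: lt_le_trans.
rewrite setTI; apply: sub_sigma_algebra.
rewrite /open/= /quotient_open.
have -> : (\pi_(quotient_topology (Quotient.quot (@two_pi_int R)))%qT @^-1`
    (angle @^-1` [set` `]a, +oo[])) =
   \bigcup_(k in [set: int]) [set` `](a + k%:~R * T), (T + k%:~R * T)[] :> set R.
  apply/seteqP; split => [x /=|x [k _]].
    rewrite in_itv/= andbT -[angle _]/(angle (to_torus x)) => ax.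
    have /andP[_ xT] := angle_itv (to_torus x).
    have /to_torus_eqP[k xk] : to_torus x = to_torus (angle (to_torus x)) by rewrite angleK.
    by exists k => //=; rewrite in_itv/= {1}xk {2}xk !ltrD2r ax xT.
  rewrite /= in_itv/= => /andP[x1 x2].
  rewrite in_itv/= andbT.
  have xk : to_torus x = to_torus (x - k%:~R * T).
    by apply/to_torus_eqP; exists k; rewrite subrK.
  by rewrite -[angle _]/(angle (to_torus x)) xk angle_to_torus; lra.
by apply: bigcup_open => k _; exact: interval_open.
Qed.

End TorusAngle.

Section ComplexParts.
Variable R : realType.

Lemma normci : `|'i%C : R[i]| = 1.
Proof. by rewrite normc_def/= expr0n expr1n/= add0r sqrtr1. Qed.

Lemma normc_ge_Im (z : R[i]) : `|complex.Im z|%:C <= `|z|.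
Proof.
have := normc_ge_Re (z * 'i%C).
by rewrite ReiNIm normrN normrM normci mulr1.
Qed.

Lemma continuous_Re : continuous (@complex.Re R : R[i]^o -> R).
Proof.
move=> z; apply/(@cvgrPdist_lt _ R _ _ (nbhs_filter (z : R[i]^o))) => e e0.
have e0' : 0 < e%:C by rewrite ltcR.
apply: filterS (nbhsx_ballx (z : R[i]^o) _ e0') => w zw.
rewrite -ltcR (le_lt_trans _ zw)//.
by have := normc_ge_Re (z - w); case: (z) (w) => [? ?] [? ?].
Qed.

Lemma continuous_Im : continuous (@complex.Im R : R[i]^o -> R).
Proof.
move=> z; apply/(@cvgrPdist_lt _ R _ _ (nbhs_filter (z : R[i]^o))) => e e0.
have e0' : 0 < e%:C by rewrite ltcR.
apply: filterS (nbhsx_ballx (z : R[i]^o) _ e0') => w zw.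
rewrite -ltcR (le_lt_trans _ zw)//.
by have := normc_ge_Im (z - w); case: (z) (w) => [? ?] [? ?].
Qed.

Lemma cvg_complex (u v : nat -> R) (a b : R) :
  u n @[n --> \oo] --> a -> v n @[n --> \oo] --> b ->
  ((u n +i* v n : R[i]^o) @[n --> \oo] --> (a +i* b : R[i]^o)).
Proof.
move=> ua vb; apply/cvgrPdist_lt => -[e ?]; rewrite ltcE/= => /andP[/eqP -> e0].
have e20 : 0 < e / 2 by rewrite divr_gt0.
move/cvgrPdist_lt : ua => /(_ _ e20) ua; move/cvgrPdist_lt : vb => /(_ _ e20) vb.
near=> n.
have un : `|a - u n| < e / 2 by near: n.
have vn : `|b - v n| < e / 2 by near: n.
have -> : (a +i* b : R[i]) - (u n +i* v n) = (a - u n)%:C + 'i%C * (b - v n)%:C.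
  by rewrite [LHS]complexE.
rewrite (le_lt_trans (ler_normD _ _))// normrM normci mul1r !normc_def/=.
rewrite !expr0n/= !addr0 !sqrtr_sqr -rmorphD/= ltcR; lra.
Unshelve. all: by end_near. Qed.

End ComplexParts.

Section TorusIntegral.
Variable R : realType.
Local Notation mu := (@lebesgue_measure R).
Local Notation T := (2 * trigo.pi : R).

Lemma Rintegral_torus (f : torus R -> R) (M : R) :
  measurable_fun setT f -> (forall th, `|f th| <= M) ->
  \int[@torus_measure R]_th f th = \int[mu]_(t in `[0, T[) f (to_torus t).
Proof.
move=> mf fM.
pose J : set (measurableTypeR R) := [set` `[0, T[].
have mJ : measurable J by exact: measurable_itv.
pose nu := mrestr mu mJ.
have mft : measurable_fun setT (f \o @to_torus R : measurableTypeR R -> R).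
  by apply: measurableT_comp => //; exact: measurable_to_torus.
have ift : nu.-integrable setT (EFin \o (f \o @to_torus R)).
  apply: (@integrable_bounded _ _ _ nu _ measurableT _ M) => //.
    by rewrite /nu/= /mrestr setTI; exact: lebesgue_measure_itv_lty.
  by move=> t _; exact: fM.
rewrite /Rintegral; congr fine.
transitivity (\int[pushforward nu (@to_torus R : measurableTypeR R -> torus R)]_th (f th)%:E)%E.
  apply: eq_measure_integral => [|? A mA _ //]; exact: measurable_to_torus.
transitivity (\int[nu]_(t in @to_torus R @^-1` setT) (f (to_torus t))%:E)%E.
  apply: (@integral_pushforward _ _ (measurableTypeR R) (torus R) _ _
    (@measurable_to_torus R) nu setT (EFin \o f)) => //.
  exact/measurable_EFinP.
rewrite preimage_setT (@negligible_integral _ _ _ nu _ (~` J))//; last 2 first.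
- exact: measurableC.
- by rewrite /nu/= /mrestr setICl measure0.
rewrite setTD setCK; apply: eq_measure_integral => A mA AJ.
by rewrite /nu/= /mrestr setIidl.
Qed.

End TorusIntegral.

Section MeasurableDerivative.
Variable R : realType.

Lemma measurable_derive1 (D : set R) (f : R -> R) :
  open D -> (forall x, D x -> derivable f x 1) -> measurable_fun D (derive1 f).
Proof.
move=> oD df; have mD := open_measurable oD.
have mfD : measurable_fun setT (f \_ D).
  apply/(measurable_restrictT _ mD); apply: open_continuous_measurable_fun => // x /set_mem Dx.
  by apply: differentiable_continuous; apply/derivable1_diffP; exact: df.
apply: (@measurable_fun_cvg _ _ R D
    (fun (n : nat) (x : R) => n.+1%:R * ((f \_ D) (x + n.+1%:R^-1) - (f \_ D) x))
    (derive1 f)) => [n|x Dx].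
  apply: measurable_funTS; apply: measurable_funM => //; apply: measurable_funB => //.
  exact: measurable_shift.
have h0 : n.+1%:R^-1 @[n --> \oo] --> (0 : R) by exact: cvg_harmonic.
have h0' : (n.+1%:R^-1 : R) @[n --> \oo] --> (0 : R)^'.
  move=> A /= A0; have hA : \forall n \near \oo, (n.+1%:R^-1 : R) != 0 -> A n.+1%:R^-1.
    exact: h0 A0.
  apply: filterS hA => n; apply.
  by rewrite invr_eq0 pnatr_eq0.
have dfx : (fun h => h^-1 *: (f (h + x) - f x)) @ (0 : R)^' --> derive1 f x.
  have := df x Dx; rewrite /derivable /derive1/=.
  under [X in cvg (X @ _)]eq_fun do rewrite [_ *: 1]mulr1.
  by [].
have := cvg_comp _ _ h0' dfx; apply: cvg_trans; apply: near_eq_cvg.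
have : \forall n \near \oo, D (x + n.+1%:R^-1).
  have : x + n.+1%:R^-1 @[n --> \oo] --> x + 0 by apply: cvgD => //; exact: cvg_cst.
  by apply; rewrite addr0; apply: open_nbhs_nbhs.
apply: filterS => n Dxn /=.
by rewrite !patchE !mem_set// invrK (addrC x).
Qed.

End MeasurableDerivative.

Lemma open_cylinder (U V : topologicalType) (A : set U) :
  open A -> open (A `*` setT : set (U * V)).
Proof.
move=> oA; rewrite openE => -[u v] [Au _]; exists (A, setT) => //.
by split; [exact: open_nbhs_nbhs|exact: filterT].
Qed.

Section LiftedObservable.
Variables (R : realType) (Omega : set R) (g : phase_space R -> R) (M : R).
Hypotheses (oO : open Omega) (cg : {within Omega `*` setT, continuous g})
  (gM : forall x, (Omega `*` setT) x -> `|g x| <= M).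

Definition cover_lift (z : measurableTypeR R * measurableTypeR R) : R :=
  ((fun y : R * R => g (y.1, to_torus y.2)) \_ (Omega `*` setT)) z.

Lemma cover_liftE I t : Omega I -> cover_lift (I, t) = g (I, to_torus t).
Proof. by move=> OI; rewrite /cover_lift patchE mem_set. Qed.

Lemma measurable_cover_lift : measurable_fun setT cover_lift.
Proof.
have oOT : open (Omega `*` setT : set (R * R)) by exact: open_cylinder.
have oOT' : open (Omega `*` setT : set (R * torus R)) by exact: open_cylinder.
apply: (@measurable_restrictT _ _ (measurableTypeR R * measurableTypeR R)%type
  (measurableTypeR R) _ _ (open_measurable_prod oOT)).1.
apply: open_continuous_measurable_prod => // -[I t] /set_mem OI.
have := cg; rewrite continuous_open_subspace// => /(_ (I, to_torus t)).
rewrite inE => /(_ OI) cgI.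
apply: (@continuous_comp _ _ _ (fun y : R * R => (y.1, to_torus y.2)) g) => //.
have cfst : (fun y : R * R => y.1) y @[y --> (I, t)] --> I by exact: cvg_fst.
have csnd : (fun y : R * R => to_torus y.2) y @[y --> (I, t)] --> to_torus t.
  by apply: (cvg_comp (@snd R R) (@to_torus R)); [exact: cvg_snd|exact: continuous_to_torus].
exact: (cvg_pair cfst csnd).
Qed.

Lemma normr_cover_lift z : `|cover_lift z| <= `|M|.
Proof.
rewrite /cover_lift patchE; case: ifPn => [/set_mem Oz|_]; last by rewrite normr0.
by rewrite (le_trans (gM _))// ?ler_norm//; case: Oz.
Qed.

Lemma cover_lift_periodic I : periodic (fun t => cover_lift (I, t)) (2 * trigo.pi).
Proof. by move=> t; rewrite /cover_lift !patchE !in_setX/= to_torus_periodic. Qed.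

End LiftedObservable.

Section PhaseMeasure.
Variable R : realType.

Lemma sigma_finite_phase_measure : sigma_finite setT (@phase_measure R).
Proof.
have [F TF Foo] := sigma_finiteT (@lebesgue_measure R).
exists (fun n => F n `*` setT).
  apply/seteqP; split => // -[I th] _.
  have [n _ FI] : (\bigcup_i F i) I by rewrite -TF.
  by exists n.
move=> n; have [mF Fn] := Foo n; split; first exact: measurableX.
rewrite /phase_measure/= product_measure1E// lte_mul_pinfty// ?ge0_fin_numE//.
by rewrite -ge0_fin_numE// fin_num_measure.
Qed.

(* The library's sigma-finite structure on product measures is not inferred, its
   key being taken by the structure for products of subprobabilities. *)
Definition sigma_finite_phase : {sigma_finite_measure set (phase_space R) -> \bar R} :=
  HB.pack (Measure.sort (@phase_measure R))
    (Measure_isSigmaFinite.Build _ _ _ (@phase_measure R) sigma_finite_phase_measure).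

End PhaseMeasure.

Section ExpectedObservable.
Variables (R : realType) (Omega : set R) (H0 : R -> R) (c : R).
Context d (W : measurableType d) (P : probability W R) (B : R -> W -> R).
Variables (g rho : phase_space R -> R) (M : R).
Hypotheses (oO : open Omega) (dH0 : forall I, Omega I -> derivable H0 I 1)
  (c0 : 0 < c) (HB : standard_brownian P B)
  (cg : {within Omega `*` setT, continuous g})
  (gM : forall x, (Omega `*` setT) x -> `|g x| <= M)
  (irho : (@phase_measure R).-integrable (Omega `*` setT) (EFin \o rho)).
Local Notation mu := (@lebesgue_measure R).
Local Notation T := (2 * trigo.pi : R).
Local Notation D := (Omega `*` setT : set (phase_space R)).
Local Notation h := (cover_lift Omega g).
Local Notation S w := (stochastic_map (derive1 H0) c (fun j => B j%:R w)).

Local Notation pm := (sigma_finite_phase R).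

Let mD : measurable D.
Proof. by apply: measurableX => //; exact: open_measurable. Qed.

Let rhoD : phase_space R -> R := rho \_ D.

Let irhoD : pm.-integrable setT (EFin \o rhoD).
Proof.
move: irho => /(integrable_mkcond _ mD); apply: eq_integrable => // x _.
by rewrite /= /rhoD !patchE; case: ifP.
Qed.

Let om : R -> R := derive1 H0 \_ Omega.

Let mom : measurable_fun setT om.
Proof.
apply: (measurable_restrictT (derive1 H0) (open_measurable oO)).1.
exact: measurable_derive1.
Qed.

Let K (j : nat) (z : phase_space R * W) : R :=
  h (z.1.1, angle z.1.2 + (j%:R * om z.1.1 + c * B j%:R z.2)).

Let mK j : measurable_fun setT (K j).
Proof.
apply: measurableT_comp; first exact: measurable_cover_lift.
apply: measurable_fun_pair; first exact: measurableT_comp.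
apply: measurable_funD.
  by apply: measurableT_comp; [exact: measurable_angle|exact: measurableT_comp].
apply: measurable_funD; apply: measurable_funM => //.
  by apply: measurableT_comp => //; exact: measurableT_comp.
by apply: measurableT_comp => //; apply: (brownian_measurable HB).
Qed.

Let KM j z : `|K j z| <= `|M|.
Proof. exact: normr_cover_lift. Qed.

Let KE j x w : D x -> K j (x, w) = g (S w j x).
Proof.
case: x => I th [/= OI _]; rewrite /K/= cover_liftE// to_torusD angleK.
by rewrite /om patchE mem_set.
Qed.

Let SectionE j w :
  \int[@phase_measure R]_(x in D) (g (S w j x) * rho x) =
  \int[pm]_x (K j (x, w) * rhoD x).
Proof.
rewrite [LHS]Rintegral_mkcond; apply: eq_Rintegral => x _.
by rewrite /rhoD !patchE; case: ifPn => [/set_mem Dx|_]; rewrite ?mulr0// KE.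
Qed.

Let one_integrable : P.-integrable setT (EFin \o (cst 1 : W -> R)).
Proof.
apply: (@integrable_bounded _ _ _ P _ measurableT _ 1) => //.
  exact: (le_lt_trans (probability_le1 P measurableT) (ltry _)).
by move=> w _ /=; rewrite normr1.
Qed.

Let Kswap j (z : W * phase_space R) := K j (z.2, z.1).

Let mKswap j : measurable_fun setT (Kswap j).
Proof. by apply: measurableT_comp => //; exact: measurable_fun_pair. Qed.

Lemma integrable_phase_average j : P.-integrable setT
  (EFin \o (fun w => \int[@phase_measure R]_(x in D) (g (S w j x) * rho x))).
Proof.
apply: (@integrable_bounded _ _ _ P _ measurableT _ (`|M| * \int[pm]_x `|rhoD x|)).
- exact: (le_lt_trans (probability_le1 P measurableT) (ltry _)).
- under eq_fun do rewrite SectionE.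
  exact: measurable_Rintegral_section irhoD (mKswap j).
- move=> w _; rewrite SectionE.
  exact: (normr_Rintegral_section irhoD (mKswap j) (fun z => KM j _) w).
Qed.

Let mean (x : phase_space R) := T^-1 * \int[mu]_(t in `[0, T[) h (x.1, t).

Let section_mean j x e : (0 < j)%N -> 0 < e ->
  `|\int[P]_w (K j (x, w) * 1) - mean x| <=
  `|M| * (e / 2 + (2 * e)^-1 * (expR ((T / c) ^+ 2 / j%:R) - 1)).
Proof.
move=> j0 e0; have jR : (0 : R) < j%:R by rewrite ltr0n.
pose p t := h (x.1, t); pose a := angle x.2 + j%:R * om x.1.
have mp : measurable_fun setT p.
  by apply: (measurableT_comp (measurable_cover_lift oO cg)); exact: pair1_measurable.
have pM t : `|p t| <= `|M| by exact: normr_cover_lift.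
under eq_Rintegral do rewrite mulr1.
have -> : \int[P]_w K j (x, w) = \int[mu]_y (p (c * y + a) * normal_pdf 0 (Num.sqrt j%:R) y).
  rewrite -(@Rintegral_brownian _ _ _ P B _ (fun y => p (c * y + a)) `|M|)//.
    by apply: eq_Rintegral => w _; rewrite /K/= /p /a; congr (h (_, _)); ring.
  by apply: measurableT_comp => //; apply: measurable_funD => //; exact: measurable_funM.
have s0 : Num.sqrt (j%:R : R) != 0 by rewrite gt_eqF// sqrtr_gt0.
have := gaussian_periodic_mean a (two_pi_gt0 R) mp pM (cover_lift_periodic _ _ _) c0 s0 e0.
by rewrite sqr_sqrtr// ltW.
Qed.

Let meanE x : D x -> T^-1 * \int[@torus_measure R]_th g (x.1, th) = mean x.
Proof.
case: x => I th0 [/= OI _]; rewrite /mean/=; congr (_ * _).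
have gh th : g (I, th) = h (I, angle th) by rewrite cover_liftE// angleK.
rewrite (@Rintegral_torus _ _ `|M|); last 2 first.
- rewrite (_ : (fun th => _) = (fun th => h (I, angle th))); last first.
    by apply/funext => th; rewrite -gh.
  apply: measurableT_comp; first exact: measurable_cover_lift.
  by apply: measurable_fun_pair => //; exact: measurable_angle.
- by move=> th; rewrite gh; exact: normr_cover_lift.
apply: eq_Rintegral => t; rewrite inE/= in_itv/= => tT.
by rewrite gh angle_to_torus.
Qed.

Let gJ (z : phase_space R * measurableTypeR R) : R := h (z.1.1, z.2).

Let mgJ : measurable_fun setT gJ.
Proof.
apply: measurableT_comp; first exact: measurable_cover_lift.
by apply: measurable_fun_pair => //; exact: measurableT_comp.
Qed.

Let gJM z : `|gJ z| <= `|M|.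
Proof. exact: normr_cover_lift. Qed.

Let iJ : mu.-integrable setT (EFin \o (\1_(`[0, T[) : R -> R)).
Proof. exact: integrable_indic_itv. Qed.

Let mean_section x : mean x = T^-1 * \int[mu]_t (gJ (x, t) * \1_(`[0, T[) t).
Proof. by rewrite /mean Rintegral_indicr. Qed.

Let mmean : measurable_fun setT mean.
Proof.
rewrite (_ : mean = fun x => T^-1 * \int[mu]_t (gJ (x, t) * \1_(`[0, T[) t)).
  by apply: measurable_funM => //; exact: measurable_Rintegral_section iJ mgJ.
by apply/funext => x; exact: mean_section.
Qed.

Let imean : pm.-integrable setT (EFin \o (fun x => mean x * rhoD x)).
Proof.
apply: (@integrable_bounded_mulr _ _ _ pm _ measurableT _ _
  (T^-1 * (`|M| * \int[mu]_t `|\1_(`[0, T[) t : R|))) => // x _.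
have T0 := two_pi_gt0 R.
rewrite mean_section normrM (@ger0_norm _ T^-1) ?invr_ge0 ?(ltW T0)// ler_pM2l ?invr_gt0//.
exact: (normr_Rintegral_section iJ mgJ gJM).
Qed.

Let limit := \int[@phase_measure R]_(x in D)
  (T^-1 * \int[@torus_measure R]_th g (x.1, th) * rho x).

Let limitE : limit = \int[pm]_x (mean x * rhoD x).
Proof.
rewrite /limit Rintegral_mkcond; apply: eq_Rintegral => x _.
by rewrite /rhoD !patchE; case: ifPn => [/set_mem Dx|_]; rewrite ?mulr0// meanE.
Qed.

Let expectation_dist j e : (0 < j)%N -> 0 < e ->
  `|\int[P]_w \int[@phase_measure R]_(x in D) (g (S w j x) * rho x) - limit| <=
  `|M| * (e / 2 + (2 * e)^-1 * (expR ((T / c) ^+ 2 / j%:R) - 1)) * \int[pm]_x `|rhoD x|.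
Proof.
move=> j0 e0.
pose E x := \int[P]_w (K j (x, w) * 1).
have -> : \int[P]_w \int[@phase_measure R]_(x in D) (g (S w j x) * rho x) =
    \int[pm]_x (rhoD x * E x).
  rewrite (Rintegral_Fubini irhoD one_integrable (mK j) (KM j)).
  by apply: eq_Rintegral => w _; rewrite mulr1 SectionE.
have iE : pm.-integrable setT (EFin \o (fun x => rhoD x * E x)).
  have mE := measurable_Rintegral_section one_integrable (mK j).
  have := integrable_bounded_mulr measurableT mE
    (fun x _ => normr_Rintegral_section one_integrable (mK j) (KM j) x) irhoD.
  by apply: eq_integrable => // x _; rewrite /= mulrC.
rewrite limitE -RintegralB//.
have iB := integrable_subr measurableT iE imean.
apply: (le_trans (le_normr_Rintegral _ iB)) => //.
have irhoDn := integrable_normr measurableT irhoD.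
rewrite -RintegralZl//; apply: le_Rintegral => //.
- exact: integrable_normr.
- exact: integrable_scaler.
- move=> x _; rewrite [rhoD x * _]mulrC -mulrBl normrM ler_wpM2r//.
  exact: section_mean.
Qed.

Lemma expectation_cvg :
  (\int[P]_w \int[@phase_measure R]_(x in D) (g (S w n.+1 x) * rho x)) @[n --> \oo]
    --> \int[@phase_measure R]_(x in D)
          (T^-1 * \int[@torus_measure R]_th g (x.1, th) * rho x).
Proof.
rewrite -/limit.
pose C := `|M| * \int[pm]_x `|rhoD x| + 1.
have C0 : 0 < C by rewrite ltr_wpDl// mulr_ge0// Rintegral_ge0.
apply/cvgrPdist_le => eps eps0.
have [e e0 ->] : exists2 e, 0 < e & eps = e * C.
  by exists (eps / C); [exact: divr_gt0|rewrite divfK// gt_eqF].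
have k0 : (T / c) ^+ 2 / n.+1%:R @[n --> \oo] --> (0 : R).
  rewrite -(mulr0 ((T / c) ^+ 2)); apply: cvgM; first exact: cvg_cst.
  exact: cvg_harmonic.
have /cvgrPdist_lt/(_ (e ^+ 2)) := cvg_comp _ _ k0 (@continuous_expR R 0).
rewrite expR0 exprn_gt0// => /(_ isT); apply: filterS => n; rewrite distrC => expn.
rewrite distrC (le_trans (expectation_dist _ e0))//.
have {}expn := le_lt_trans (ler_norm _) expn.
have de : e / 2 + (2 * e)^-1 * (expR ((T / c) ^+ 2 / n.+1%:R) - 1) <= e.
  rewrite -lerBrDl (_ : e - e / 2 = (2 * e)^-1 * e ^+ 2); last by field; rewrite gt_eqF.
  by rewrite ler_wpM2l ?invr_ge0 ?mulr_ge0 ?(ltW e0)// ltW.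
rewrite mulrAC mulrC ler_pM ?mulr_ge0 ?Rintegral_ge0//; last by rewrite lerDl.
rewrite addr_ge0 ?mulr_ge0 ?invr_ge0 ?mulr_ge0 ?(ltW e0)//.
by rewrite subr_ge0 -expR0 ler_expR divr_ge0 ?sqr_ge0.
Qed.

End ExpectedObservable.

Section Assembly.
Variable R : realType.

Lemma Rintegral_sum d (X : measurableType d) (m : {measure set X -> \bar R}) (D : set X)
    (I : Type) (s : seq I) (f : I -> X -> R) : measurable D ->
  (forall i, m.-integrable D (EFin \o f i)) ->
  m.-integrable D (EFin \o (fun x => \sum_(i <- s) f i x)) /\
  \int[m]_(x in D) (\sum_(i <- s) f i x) = \sum_(i <- s) \int[m]_(x in D) f i x.
Proof.
move=> mD fi; elim: s => [|i s [IHi IH]].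
  split; first by apply: eq_integrable (integrable0 m D) => // x _; rewrite /= big_nil.
  rewrite big_nil; under eq_Rintegral do rewrite big_nil.
  by rewrite Rintegral_cst// mul0r.
have iis := integrable_addr mD (fi i) IHi.
split; first by apply: eq_integrable iis => // x _; rewrite /= big_cons.
by under eq_Rintegral do rewrite big_cons; rewrite RintegralD// IH big_cons.
Qed.

Definition cpart (b : bool) (z : R[i]) : R :=
  if b then complex.Re z else complex.Im z.

Lemma cpartD b : {morph cpart b : x y / x + y}.
Proof. by case: b => -[? ?] [? ?]. Qed.

Lemma cpartMr b z r : cpart b (z * r%:C) = cpart b z * r.
Proof. by case: b; case: z => x y; rewrite /cpart/=; ring. Qed.

Lemma cpart_cintegral b d (X : measurableType d) (m : {measure set X -> \bar R}) D
  (f : X -> R[i]) : cpart b (cintegral m D f) = \int[m]_(x in D) cpart b (f x).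
Proof. by case: b. Qed.

Lemma continuous_cpart b : continuous (cpart b : R[i]^o -> R).
Proof. by case: b; [exact: continuous_Re|exact: continuous_Im]. Qed.

Lemma normr_cpart b z : `|cpart b z|%:C <= `|z|.
Proof. by case: b; [exact: normc_ge_Re|exact: normc_ge_Im]. Qed.

Lemma cpart_phase_average b Omega rho (F : phase_space R -> R[i]) :
  cpart b (phase_average Omega rho F) =
  \int[@phase_measure R]_(x in Omega `*` setT) (cpart b (F x) * rho x).
Proof. by rewrite cpart_cintegral; under eq_Rintegral do rewrite cpartMr. Qed.

Lemma cpart_time_average b Omega rho S G N :
  cpart b (time_average Omega rho S G N) =
  N%:R^-1 * \sum_(1 <= j < N.+1)
    \int[@phase_measure R]_(x in Omega `*` setT) (cpart b (G (S j x)) * rho x).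
Proof.
have cpart0 : cpart b 0 = 0 by case: b.
have NV : N%:R^-1 = (N%:R^-1)%:C :> R[i] by rewrite fmorphV rmorph_nat.
rewrite /time_average NV mulrC cpartMr mulrC.
congr (_ * _); rewrite (big_morph _ (cpartD b) cpart0).
by apply: eq_bigr => j _; rewrite cpart_phase_average.
Qed.

Lemma cpart_angle_average b G I :
  cpart b (angle_average G I) =
  (2 * trigo.pi)^-1 * \int[@torus_measure R]_th cpart b (G (I, th)).
Proof. by rewrite /angle_average mulrC cpartMr cpart_cintegral mulrC. Qed.

Lemma integrable_density (Omega : set R) rho : open Omega ->
  probability_density Omega rho -> measurable_fun setT (rho \_ (Omega `*` setT)) ->
  (@phase_measure R).-integrable (Omega `*` setT) (EFin \o rho).
Proof.
move=> oO [rho0 rho1] mrho.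
have mD : measurable (Omega `*` setT : set (phase_space R)).
  by apply: measurableX => //; exact: open_measurable.
have {}mrho := (measurable_restrictT rho mD).2 mrho.
apply/integrableP; split; first exact/measurable_EFinP.
rewrite (_ : (\int[_]_(x in _) _)%E = 1%E) ?ltry// -rho1.
apply: ae_eq_integral => //.
- by do 2 apply: measurableT_comp => //; exact/measurable_EFinP.
- exact/measurable_EFinP.
- have FF := ae_filter_ringOfSetsType (@phase_measure R).
  by apply: (@filterS _ _ FF _ _ _ rho0) => x r0 Dx; rewrite /= ger0_norm// r0.
Qed.

End Assembly.

Theorem theorem3p2 (R : realType) (Omega : set R) (H0 : R -> R) (c : R)
    (d : measure_display) (W : measurableType d) (P : probability W R)
    (B : R -> W -> R)
    (G : phase_space R -> R[i]^o) (rho0 : phase_space R -> R) :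
  open Omega -> bounded_set Omega ->
  (forall I, Omega I -> derivable H0 I 1) ->
  0 < c ->
  standard_brownian P B ->
  bounded_continuous Omega G ->
  probability_density Omega rho0 ->
  rho0 \_ (Omega `*` setT) \in Lfun (@phase_measure R) 2%:E ->
  let S (w : W) := stochastic_map (derive1 H0) c (fun j => B j%:R w) in
  let V (N : nat) (w : W) := time_average Omega rho0 (S w) G N in
  cintegral P setT (V N) @[N --> \oo] -->
    phase_average Omega rho0 (fun x => angle_average G x.1).
Proof.
move=> oO _ dH0 c0 HB [cG [M GM]] rho_density rhoL2 S V.
have mrho : measurable_fun setT (rho0 \_ (Omega `*` setT)).
  by move: rhoL2; rewrite inE => /andP[+ _]; rewrite inE.
have irho := integrable_density oO rho_density mrho.
have part b : cpart b (cintegral P setT (V N)) @[N --> \oo] -->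
    cpart b (phase_average Omega rho0 (fun x => angle_average G x.1)).
  pose g x := cpart b (G x).
  have cg : {within Omega `*` setT, continuous g}.
    by move=> x; apply: continuous_comp; [exact: cG|exact: continuous_cpart].
  have gM x : (Omega `*` setT) x -> `|g x| <= M.
    by move=> Dx; rewrite -lecR (le_trans (normr_cpart b _))// GM.
  pose a j w := \int[@phase_measure R]_(x in Omega `*` setT) (g (S w j x) * rho0 x).
  have ia j : P.-integrable setT (EFin \o a j) by exact: integrable_phase_average gM irho j.
  have VE N : cpart b (cintegral P setT (V N)) =
      N%:R^-1 * \sum_(1 <= j < N.+1) \int[P]_w a j w.
    have [isum sumE] := Rintegral_sum (index_iota 1 N.+1) measurableT ia.
    rewrite cpart_cintegral -sumE -RintegralZl//.
    by apply: eq_Rintegral => w _; rewrite cpart_time_average.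
  have mean_cvg := cesaro (expectation_cvg oO dH0 c0 HB cg gM irho).
  have -> : cpart b (phase_average Omega rho0 (fun x => angle_average G x.1)) =
      \int[@phase_measure R]_(x in Omega `*` setT)
        ((2 * trigo.pi)^-1 * \int[@torus_measure R]_th g (x.1, th) * rho0 x).
    rewrite cpart_phase_average; apply: eq_Rintegral => x _.
    by rewrite cpart_angle_average.
  rewrite -cvg_shiftS; apply: cvg_trans mean_cvg; apply: near_eq_cvg; apply: nearW => n.
  by rewrite /= VE big_add1 /arithmetic_mean /series.
exact: cvg_complex (part true) (part false).
Qed.
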